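(* Let $m \geq n$, $A \in \mathbb{C}^{m\times m}$ and $B \in \mathbb{C}^{n \times n}$ be normal matrices, and let $X \in \mathbb{C}^{m\times n}$ satisfy $AX - XB = F$. Let $z_0, \eta \in \mathbb{R}$ with $0 < \eta < z_0$, let $E = \{ z \in \mathbb{C} : |z - z_0| \leq \eta\}$, and suppose that every eigenvalue of $A$ lies in $E$ and every eigenvalue of $B$ lies in $-E = \{-z : z \in E\}$. Set $\phi = \sqrt{z_0^2 - \eta^2}$ and $\mu_1 = (z_0 + \phi)/(z_0 - \phi)$. Suppose that there is a constant $K \geq 1$ such that $\sigma_{j+1}(F) \leq K \mu_1^{-j} \|F\|_2$ for all $0 \leq j < n$. Then for every triangular number $t = k(k+1)/2$ (with $k$ a positive integer) satisfying $1 \leq t < n$, \[ \sigma_{t+1}(X) \leq K\, \frac{z_0+\eta}{z_0-\eta}\, \left(\tfrac{3}{2}\sqrt{t} + 1\right) \mu_1^{-(\sqrt{8t+1}-1)/2}\, \|X\|_2 . \]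
   Context: For a matrix $M$, $\sigma_j(M)$ denotes its $j$th largest singular value, with $\sigma_j(M) = 0$ if $j$ exceeds the smaller dimension of $M$, and $\|M\|_2 = \sigma_1(M)$ is the spectral norm. *)

(* Defs.v *)
From HB Require Import structures.
From mathcomp Require Import all_boot all_order all_algebra.
From mathcomp Require Import reals exp.
From mathcomp.real_closed Require Import complex.
Set Implicit Arguments. Unset Strict Implicit. Unset Printing Implicit Defensive.
Import Order.TTheory GRing.Theory Num.Theory.
Local Open Scope ring_scope.
Local Open Scope complex_scope.

Definition conjT (R : rcfType) (m n : nat) (M : 'M[R[i]]_(m, n)) : 'M[R[i]]_(n, m) :=
  (map_mx conjc M)^T.

Definition normal_mx (R : rcfType) (n : nat) (A : 'M[R[i]]_n) : Prop :=
  A *m conjT A = conjT A *m A.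

(* The eigenvalues (with algebraic multiplicity, in some order) of M^* M,
   i.e. the roots of its characteristic polynomial. *)
Definition gram_eigs (R : rcfType) (m n : nat) (M : 'M[R[i]]_(m, n)) : seq R[i] :=
  sval (closed_field_poly_normal (char_poly (conjT M *m M))).

(* sing_val M j = sigma_j(M), the j-th largest singular value (1-indexed, j >= 1):
   the square root of the j-th largest eigenvalue (counted with multiplicity) of
   the positive semidefinite Hermitian matrix M^* M (its eigenvalues are real, so
   we take real parts).  If j exceeds the number of columns n the default 0 is
   used; if m < j <= n the corresponding eigenvalue of M^* M is 0 anyway, so
   sigma_j(M) = 0 whenever j > min(m, n), as in the paper's convention. *)
Definition sing_val (R : rcfType) (m n : nat) (M : 'M[R[i]]_(m, n)) (j : nat) : R :=
  Num.sqrt (nth 0 (sort (fun x y : R => y <= x)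
                        [seq complex.Re z | z <- gram_eigs M]) j.-1).

Definition norm2 (R : rcfType) (m n : nat) (M : 'M[R[i]]_(m, n)) : R := sing_val M 1.

(* Main.v *)
Require Import Defs.
From HB Require Import structures.
From mathcomp Require Import all_boot all_order all_algebra.
From mathcomp Require Import reals exp.
From mathcomp.real_closed Require Import complex.
From mathcomp Require Import perm ring lra.
Import Order.TTheory GRing.Theory Num.Theory.
Local Open Scope ring_scope.
Local Open Scope complex_scope.

(** The row-vector operator norm is used on conjugate transposes, so that
    N = X^* solves N A^* + (-B)^* N = F^* and both A and -B have spectrum in
    the disk E.  One ADI step with shifts phi and -phi writes
    N = D N C + H, where D and C are Cayley transforms of norm at most
    mu1^(-1/2) (the boundary of E is an Apollonius circle of the two shifts) and
    H is a multiple of F^* between two resolvents.  If Y approximates N after k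
    steps and Z has rank k+1 and approximates H, then D Y C + Z is the next
    approximant, with error D (N - Y) C + (H - Z).  Since the singular values
    of F decay like mu1^(-j), the rank after k steps is at most
    1 + 2 + ... + k = t and the error is at most mu1^(-k) (|N| + k h), where
    h = K 2 phi |F| / (z0 - eta + phi)^2 <= K (z0 + eta) / (z0 - eta) |X|. *)

Set Implicit Arguments.
Unset Strict Implicit.
Unset Printing Implicit Defensive.

Local Open Scope sesquilinear_scope.

(** * Euclidean norm of row vectors and operator bounds *)

Definition hnorm (C : numClosedFieldType) (n : nat) (u : 'rV[C]_n) : C :=
  sqrtC (dotmx u u).

(** The spectral norm enters only through upper bounds, so it is a relation instead of a supremum.
    The bound lies in [C] because [hnorm] takes its values there. *)
Definition op_le (C : numClosedFieldType) (m n : nat) (M : 'M[C]_(m, n)) (c : C) :=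
  forall u : 'rV[C]_m, hnorm (u *m M) <= c * hnorm u.

Section OperatorNorm.
Variable C : numClosedFieldType.

Lemma hnorm_ge0 (n : nat) (u : 'rV[C]_n) : 0 <= hnorm u.
Proof. exact: sqrt_dnorm_ge0. Qed.

Lemma sqr_hnorm (n : nat) (u : 'rV[C]_n) :
  hnorm u ^+ 2 = (u *m u ^t* ) 0 0.
Proof. by rewrite sqrtCK dotmxE. Qed.

Lemma sqr_hnormE (n : nat) (u : 'rV[C]_n) :
  hnorm u ^+ 2 = \sum_j `|u 0 j| ^+ 2.
Proof.
by rewrite sqr_hnorm mxE; apply: eq_bigr => j _; rewrite !mxE normCK.
Qed.

Lemma ler_hnorm (m n : nat) (u : 'rV[C]_m) (v : 'rV[C]_n) c : 0 <= c ->
  hnorm u ^+ 2 <= c ^+ 2 * hnorm v ^+ 2 -> hnorm u <= c * hnorm v.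
Proof.
move=> c0; rewrite -exprMn ler_pXn2r ?nnegrE ?hnorm_ge0 //.
by rewrite mulr_ge0 ?hnorm_ge0.
Qed.

Lemma hnormD_le (n : nat) (u v : 'rV[C]_n) : hnorm (u + v) <= hnorm u + hnorm v.
Proof. exact: (triangle_lerif (@dotmx C n) u v).1. Qed.

Lemma hnormZ (n : nat) a (u : 'rV[C]_n) : hnorm (a *: u) = `|a| * hnorm u.
Proof.
by rewrite /hnorm dnormZ sqrtCM ?nnegrE ?exprn_ge0 ?dnorm_ge0 // sqrCK.
Qed.

Lemma hnorm_unitary (m n : nat) (U : 'M[C]_(m, n)) u :
  U \is unitarymx -> hnorm (u *m U) = hnorm u.
Proof.
move=> Uu; rewrite /hnorm !dotmxE trmx_mul map_mxM mulmxA.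
by rewrite -[u *m U *m _]mulmxA (unitarymxP Uu) mulmx1.
Qed.

Lemma op_leD (m n : nat) (M N : 'M[C]_(m, n)) c d :
  op_le M c -> op_le N d -> op_le (M + N) (c + d).
Proof.
move=> Mc Nd u; rewrite mulmxDr mulrDl.
by apply: le_trans (hnormD_le _ _) _; apply: lerD.
Qed.

Lemma op_leM (m n p : nat) (M : 'M[C]_(m, n)) (N : 'M[C]_(n, p)) c d :
  0 <= d -> op_le M c -> op_le N d -> op_le (M *m N) (c * d).
Proof.
move=> d0 Mc Nd u; rewrite mulmxA; apply: le_trans (Nd _) _.
by rewrite [c * d]mulrC -mulrA; apply: ler_wpM2l.
Qed.

Lemma op_leZ (m n : nat) (M : 'M[C]_(m, n)) a c :
  op_le M c -> op_le (a *: M) (`|a| * c).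
Proof. by move=> Mc u; rewrite -scalemxAr hnormZ -mulrA ler_wpM2l. Qed.

Lemma op_le_trans (m n : nat) (M : 'M[C]_(m, n)) c d :
  c <= d -> op_le M c -> op_le M d.
Proof.
by move=> cd Mc u; apply: le_trans (Mc u) _; rewrite ler_wpM2r ?hnorm_ge0.
Qed.

Lemma op_le_unitary (m n : nat) (U : 'M[C]_(m, n)) :
  U \is unitarymx -> op_le U 1.
Proof. by move=> Uu u; rewrite hnorm_unitary // mul1r. Qed.

Lemma op_le_diag (n : nat) (d : 'rV[C]_n) c :
  0 <= c -> (forall i, `|d 0 i| <= c) -> op_le (diag_mx d) c.
Proof.
move=> c0 dc u; apply: ler_hnorm => //; rewrite !sqr_hnormE mulr_sumr.
apply: ler_sum => j _; rewrite mul_mx_diag mxE normrM exprMn mulrC.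
by rewrite ler_wpM2r ?exprn_ge0 // lerXn2r // ?nnegrE.
Qed.

Lemma op_le_conj_diag (n : nat) (P : 'M[C]_n) (d : 'rV[C]_n) c :
  P \is unitarymx -> 0 <= c -> (forall i, `|d 0 i| <= c) ->
  op_le (P^t* *m diag_mx d *m P) c.
Proof.
move=> Pu c0 dc; rewrite -[c]mulr1 -[c in c * 1]mul1r.
apply: op_leM => //; last exact: op_le_unitary.
apply: op_leM => //; last exact: op_le_diag.
by apply: op_le_unitary; rewrite trmxC_unitary.
Qed.

End OperatorNorm.

(** * Singular values and low-rank approximation *)

Lemma conjTE (R : rcfType) (m n : nat) (M : 'M[R[i]]_(m, n)) : conjT M = M^t*.
Proof. by apply/matrixP => i j; rewrite !mxE. Qed.

Lemma conjTN (R : rcfType) (m n : nat) (M : 'M[R[i]]_(m, n)) :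
  conjT (- M) = - conjT M.
Proof. by rewrite !conjTE -map_mxN [(- M)^T]raddfN. Qed.

(** Lifted to polynomial matrices, [P^t*] and [P] stay mutually inverse, so their determinants
    cancel and only the diagonal factor is left. *)
Lemma char_poly_conj_diag (C : numClosedFieldType) (n : nat) (P : 'M[C]_n)
    (d : 'rV[C]_n) :
  P \is unitarymx ->
  char_poly (P^t* *m diag_mx d *m P) = \prod_(i < n) ('X - (d 0 i)%:P).
Proof.
move=> Pu; have PtP : P^t* *m P = 1%:M.
  by rewrite -invmx_unitary // mulVmx // unitarymx_unit.
rewrite /char_poly /char_poly_mx !map_mxM /=.
set Q := map_mx polyC (P^t* ); set S := map_mx polyC P.
have QS : Q *m S = 1%:M by rewrite -map_mxM PtP map_mx1.
have -> : 'X%:M - Q *m map_mx polyC (diag_mx d) *m S =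
    Q *m ('X%:M - map_mx polyC (diag_mx d)) *m S.
  by rewrite mulmxBr mulmxBl scalar_mxC -[_ *m Q *m S]mulmxA QS mulmx1.
rewrite !det_mulmx mulrAC -det_mulmx QS det1 mul1r.
rewrite -/(char_poly (diag_mx d)) char_poly_trig ?diag_mx_is_trig //.
by apply: eq_bigr => i _; rewrite mxE eqxx mulr1n.
Qed.

(** Half of a singular value decomposition: the rows of [W] are orthonormal eigenvectors of the Gram
    matrix, ordered by decreasing singular value. All later facts that relate [sing_val] to operator
    bounds go through this identity. *)
Lemma gram_diag (R : rcfType) (m n : nat) (M : 'M[R[i]]_(m, n)) :
  exists2 W : 'M[R[i]]_n, W \is unitarymx &
    forall c : 'rV_n, hnorm (c *m W *m M^t* ) ^+ 2 =
      \sum_j `|c 0 j| ^+ 2 * ((sing_val M j.+1)%:C) ^+ 2.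
Proof.
pose H := M^t* *m M.
have Hh : H^t* = H by rewrite trmx_mul map_mxM trmxCK.
have /orthomx_spectralP : H \is normalmx by apply/normalmxP; rewrite Hh.
set P := spectralmx H; set s := spectral_diag H.
have Pu : P \is unitarymx := spectral_unitarymx H.
rewrite invmx_unitary // => HE.
(* The roots in [gram_eigs] come in an unspecified order; factoring the same polynomial twice
   identifies them with the spectral diagonal as a multiset. *)
have gramP : perm_eq (gram_eigs M) [seq s 0 i | i : 'I_n].
  apply: prod_XsubC_eq; rewrite /gram_eigs.
  case: closed_field_poly_normal => r /= /esym; rewrite conjTE -/H.
  rewrite (monicP (char_poly_monic _)) scale1r => ->.
  by rewrite HE char_poly_conj_diag // big_map big_enum.
have PHP : P *m H *m P^t* = diag_mx s.
  by rewrite HE !mulmxA (unitarymxP Pu) mul1mx -mulmxA (unitarymxP Pu) mulmx1.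
have s_ge0 i : 0 <= s 0 i.
  have Es : (P *m M^t* ) *m (P *m M^t* )^t* = diag_mx s.
    by rewrite trmx_mul map_mxM trmxCK -PHP !mulmxA.
  move/matrixP/(_ i i): Es; rewrite !mxE eqxx mulr1n => <-.
  by apply: sumr_ge0 => j _; rewrite !mxE mul_conjC_ge0.
have [p pP] : exists p : {perm 'I_n},
    sort (fun x y : R => y <= x) [seq complex.Re z | z <- gram_eigs M] =
    [tuple tnth [tuple complex.Re (s 0 i) | i < n] (p i) | i < n].
  apply/tuple_permP; rewrite perm_sort /=.
  rewrite (perm_trans (perm_map _ gramP)) // -map_comp.
  exact: perm_refl.
(* Since the eigenvalues are nonnegative, neither taking real parts nor the real square root loses
   information. *)
have sE j : ((sing_val M (val j).+1)%:C) ^+ 2 = s 0 (p j) :> R[i].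
  rewrite /sing_val /= pP -tnth_nth !tnth_mktuple -rmorphXn /= sqr_sqrtr.
    by rewrite RRe_real // ger0_real.
  by have := s_ge0 (p j); rewrite lecE => /andP[].
exists (row_perm p P) => [|c].
  apply/unitarymxP; rewrite row_permE trmx_mul map_mxM mulmxA mulmxtVK //.
  by rewrite tr_perm_mx map_perm_mx -perm_mxM mulgV perm_mx1.
rewrite mul_row_perm; set c' := col_perm _ c.
have -> : hnorm (c' *m P *m M^t* ) ^+ 2 = (c' *m diag_mx s *m c'^t* ) 0 0.
  by rewrite sqr_hnorm -PHP !trmx_mul !map_mxM trmxCK !mulmxA.
rewrite mxE (reindex_inj (@perm_inj _ p)); apply: eq_bigr => j _.
by rewrite mul_mx_diag !mxE permK sE normCK mulrAC.
Qed.

Lemma sing_val_ge0 (R : rcfType) (m n : nat) (M : 'M[R[i]]_(m, n)) j :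
  0 <= sing_val M j.
Proof. exact: sqrtr_ge0. Qed.

Lemma size_gram_eigs (R : rcfType) (m n : nat) (M : 'M[R[i]]_(m, n)) :
  size (gram_eigs M) = n.
Proof.
apply: succn_inj; rewrite -(size_char_poly (conjT M *m M)) /gram_eigs.
case: closed_field_poly_normal => r /= ->.
by rewrite (monicP (char_poly_monic _)) scale1r size_prod_XsubC.
Qed.

Lemma sing_val_antitone (R : rcfType) (m n : nat) (M : 'M[R[i]]_(m, n)) i j :
  (i <= j)%N -> (j < n)%N -> sing_val M j.+1 <= sing_val M i.+1.
Proof.
move=> ij jn; apply: ler_wsqrtr => /=.
have szs : size (sort (fun x y : R => y <= x)
    [seq complex.Re z | z <- gram_eigs M]) = n.
  by rewrite size_sort size_map size_gram_eigs.
apply: (sorted_leq_nth (leT := fun x y : R => y <= x)) => //.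
- by move=> y x z yx zy; apply: le_trans zy yx.
- by apply: sort_sorted => x y; rewrite le_total.
- by rewrite inE szs (leq_ltn_trans ij).
- by rewrite inE szs.
Qed.

(** Lower half of the Eckart-Young theorem. The span of the first t+1 rows of [W] contains a nonzero
    vector killed by [Y]; on it [M^t* - Y] agrees with [M^t*], which stretches it by at least the
    (t+1)st singular value. *)
Lemma sing_val_le_rank (R : rcfType) (m n t : nat) (M : 'M[R[i]]_(m, n))
    (Y : 'M[R[i]]_(n, m)) (c : R) :
  0 <= c -> (\rank Y <= t)%N -> op_le (M^t* - Y) c%:C -> sing_val M t.+1 <= c.
Proof.
(* For n <= t the singular value is the default 0. *)
move=> c0 rY Yc; have [tn|nt] := ltnP t n; last first.
  by rewrite /sing_val nth_default ?sqrtr0 // size_sort size_map size_gram_eigs.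
have [W Wu WE] := gram_diag M.
(* Dimension count: the coordinate space has dimension t+1, while [W *m Y] has rank at most t. *)
have : (0 < \rank ((pid_mx t.+1 : 'M[R[i]]_n) :&: kermx (W *m Y))%MS)%N.
  have := mxrank_mul_ker (pid_mx t.+1 : 'M[R[i]]_n) (W *m Y).
  rewrite rank_pid_mx // => eqr.
  rewrite -(ltn_add2l (\rank ((pid_mx t.+1 : 'M[R[i]]_n) *m (W *m Y)))).
  rewrite addn0 eqr ltnS; apply: leq_trans rY.
  by rewrite mulmxA mxrankM_maxr.
rewrite lt0n mxrank_eq0 => /rowV0Pn[v]; rewrite sub_capmx.
move=> /andP[/submxP[w vE] /sub_kermxP vK] v0.
have vj j : (t < val j)%N -> v 0 j = 0.
  move=> tj; rewrite vE mxE big1 // => k _; rewrite mxE.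
  by have [kj|] := eqVneq (val k) (val j); rewrite ?mulr0 // kj ltnNge tj mulr0.
have hv : 0 < hnorm v by rewrite sqrtC_gt0 dnorm_gt0.
have := Yc (v *m W); rewrite mulmxBr -[v *m W *m Y]mulmxA vK subr0.
rewrite (hnorm_unitary v Wu) => le1.
suff le2 : (sing_val M t.+1)%:C * hnorm v <= hnorm (v *m W *m M^t* ).
  by rewrite -lecR -(ler_pM2r hv) (le_trans le2 le1).
rewrite -(@ler_pXn2r _ 2) ?nnegrE ?mulr_ge0 ?hnorm_ge0 ?ler0c ?sing_val_ge0 //.
rewrite exprMn WE sqr_hnormE mulr_sumr; apply: ler_sum => j _.
have [/vj->|jt] := ltnP t (val j); first by rewrite normr0 expr0n mulr0 mul0r.
rewrite mulrC ler_wpM2l ?exprn_ge0 // lerXn2r ?nnegrE ?ler0c ?sing_val_ge0 //.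
by rewrite lecR sing_val_antitone.
Qed.

(** Upper half of the Eckart-Young theorem: project onto the first t rows of [W], then apply [M^t*].
    The error involves only the remaining coordinates, whose singular values are at most the
    (t+1)st. *)
Lemma low_rank_approx (R : rcfType) (m n t : nat) (M : 'M[R[i]]_(m, n)) :
  (t < n)%N ->
  exists2 Y : 'M[R[i]]_(n, m), (\rank Y <= t)%N &
    op_le (M^t* - Y) (sing_val M t.+1)%:C.
Proof.
move=> tn; have [W Wu WE] := gram_diag M.
have WtW : W^t* *m W = 1%:M.
  by rewrite -invmx_unitary // mulVmx // unitarymx_unit.
exists (W^t* *m pid_mx t *m W *m M^t* ).
  rewrite -!mulmxA; apply: leq_trans (mxrankM_maxr _ _) _.
  apply: leq_trans (mxrankM_maxl _ _) _.
  by rewrite rank_pid_mx // ltnW.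
have -> : M^t* - W^t* *m pid_mx t *m W *m M^t* =
    W^t* *m copid_mx t *m W *m M^t*.
  by rewrite mulmxBr mulmx1 !mulmxBl WtW mul1mx.
move=> u; rewrite !mulmxA -[in leRHS](@hnorm_unitary _ _ _ (W^t* ) u); last first.
  by rewrite trmxC_unitary.
move: (u *m W^t* ) => {u} v; apply: ler_hnorm; first by rewrite ler0c sing_val_ge0.
rewrite WE sqr_hnormE mulr_sumr; apply: ler_sum => j _.
have -> : (v *m copid_mx t) 0 j = if (j < t)%N then 0 else v 0 j.
  rewrite mulmxBr mulmx1 !mxE (bigD1 j) //= big1 => [|k kj]; rewrite !mxE.
    by rewrite eqxx addr0; case: ifP => _; rewrite ?mulr1 ?subrr ?mulr0 ?subr0.
  by rewrite -val_eqE in kj; rewrite (negPf kj) mulr0.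
case: ltnP => [_|tj].
  by rewrite normr0 expr0n mul0r mulr_ge0 ?exprn_ge0 // ler0c sing_val_ge0.
rewrite mulrC ler_wpM2r ?exprn_ge0 // lerXn2r ?nnegrE ?ler0c ?sing_val_ge0 //.
by rewrite lecR sing_val_antitone.
Qed.

(** The case t = 0 of the approximation, where the approximant has rank 0 and vanishes. *)
Lemma op_le_norm2 (R : rcfType) (m n : nat) (M : 'M[R[i]]_(m, n)) :
  (0 < n)%N -> op_le (M^t* ) (norm2 M)%:C.
Proof.
by move=> /(low_rank_approx M)[Y]; rewrite leqn0 mxrank_eq0 => /eqP->; rewrite subr0.
Qed.

Lemma norm2_ge0 (R : rcfType) (m n : nat) (M : 'M[R[i]]_(m, n)) : 0 <= norm2 M.
Proof. exact: sing_val_ge0. Qed.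

Lemma norm2_le (R : rcfType) (m n : nat) (M : 'M[R[i]]_(m, n)) c :
  0 <= c -> op_le (M^t* ) c%:C -> norm2 M <= c.
Proof.
by move=> c0 Mc; apply: (@sing_val_le_rank _ _ _ _ _ 0); rewrite ?mxrank0 ?subr0.
Qed.

(** * Low-rank approximation for a Stein equation *)

(** Each step contracts the old error by r^2, and the rank k+1 approximation of [H] has error h
    r^(2(k+1)). Once the common power of r is factored out, a step therefore adds just one h. *)
Lemma stein_low_rank (C : numClosedFieldType) (m n k : nat)
    (N H : 'M[C]_(n, m)) (D : 'M[C]_n) (E : 'M[C]_m) (r x h : C) :
  0 <= r -> 0 <= x -> 0 <= h -> N = D *m N *m E + H ->
  op_le D r -> op_le E r -> op_le N x ->
  (forall i, (0 < i <= k)%N -> exists2 Z : 'M[C]_(n, m),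
     (\rank Z <= i)%N & op_le (H - Z) (h * (r ^+ 2) ^+ i)) ->
  exists2 Y : 'M[C]_(n, m), (\rank Y <= 'C(k.+1, 2))%N &
    op_le (N - Y) ((r ^+ 2) ^+ k * (x + k%:R * h)).
Proof.
move=> r0 x0 h0 NE Dr Er Nx; elim: k => [_|k IHk HZ].
  by exists 0; rewrite ?mxrank0 // subr0 expr0 mul1r mul0r addr0.
have [i /andP[i0 ik]|Y rY NY] := IHk.
  by apply: HZ; rewrite i0 ltnW.
have [|Z rZ HZk] := HZ k.+1; first by rewrite ltnSn.
exists (D *m Y *m E + Z).
  (* Pascal's rule: the binomial coefficient grows by exactly k+1, the rank of the new summand. *)
  rewrite binS bin1 (leq_trans (mxrank_add _ _)) // leq_add //.
  by rewrite (leq_trans (mxrankM_maxl _ _)) // (leq_trans (mxrankM_maxr _ _)).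
have -> : N - (D *m Y *m E + Z) = D *m (N - Y) *m E + (H - Z).
  rewrite {1}NE mulmxBr mulmxBl opprD !addrA; congr (_ - _).
  by rewrite addrAC.
have -> : (r ^+ 2) ^+ k.+1 * (x + k.+1%:R * h) =
    r * ((r ^+ 2) ^+ k * (x + k%:R * h)) * r + h * (r ^+ 2) ^+ k.+1.
  by rewrite -natr1 exprS; ring.
apply: op_leD => //; do 2![apply: op_leM => //].
by rewrite mulr_ge0 ?addr_ge0 ?mulr_ge0 ?exprn_ge0.
Qed.

(** * Matrices diagonal in a fixed unitary basis *)

(** The eigenvalues form a function, so that sums, products and adjoints act pointwise: a functional
    calculus for one normal matrix. *)
Definition unitary_diag (C : numClosedFieldType) (n : nat) (P : 'M[C]_n)
  (d : 'I_n -> C) : 'M[C]_n := P^t* *m diag_mx (\row_i d i) *m P.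

Section UnitaryDiag.
Variables (C : numClosedFieldType) (n : nat) (P : 'M[C]_n).
Hypothesis P_unitary : P \is unitarymx.

Lemma eq_unitary_diag (d e : 'I_n -> C) :
  d =1 e -> unitary_diag P d = unitary_diag P e.
Proof.
by move=> de; rewrite /unitary_diag; congr (_ *m diag_mx _ *m _);
  apply/rowP => i; rewrite !mxE.
Qed.

Lemma unitary_diagM (d e : 'I_n -> C) :
  unitary_diag P d *m unitary_diag P e = unitary_diag P (fun i => d i * e i).
Proof.
rewrite /unitary_diag [LHS]mulmxA [_ *m P *m _]mulmxA.
rewrite mulmxtVK //.
rewrite -[_ *m diag_mx _ *m diag_mx _]mulmxA mulmx_diag.
by congr (_ *m diag_mx _ *m _); apply/rowP => i; rewrite !mxE.
Qed.

Lemma unitary_diagD (d e : 'I_n -> C) :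
  unitary_diag P d + unitary_diag P e = unitary_diag P (fun i => d i + e i).
Proof.
rewrite /unitary_diag -mulmxDl -mulmxDr -raddfD.
by congr (_ *m diag_mx _ *m _); apply/rowP => i; rewrite !mxE.
Qed.

Lemma unitary_diagN (d : 'I_n -> C) :
  - unitary_diag P d = unitary_diag P (fun i => - d i).
Proof.
rewrite /unitary_diag -mulNmx -mulmxN -raddfN.
by congr (_ *m diag_mx _ *m _); apply/rowP => i; rewrite !mxE.
Qed.

Lemma unitary_diag_const (c : C) : unitary_diag P (fun=> c) = c%:M.
Proof.
rewrite /unitary_diag (_ : \row__ c = const_mx c); last first.
  by apply/rowP => i; rewrite !mxE.
rewrite diag_const_mx scalar_mxC -mulmxA -invmx_unitary // mulVmx ?mulmx1 //.
exact: unitarymx_unit.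
Qed.

Lemma unitary_diag_adjoint (d : 'I_n -> C) :
  (unitary_diag P d)^t* = unitary_diag P (fun i => Num.conj (d i)).
Proof.
rewrite /unitary_diag !trmx_mul !map_mxM trmxCK mulmxA tr_diag_mx map_diag_mx.
by congr (_ *m diag_mx _ *m _); apply/rowP => i; rewrite !mxE.
Qed.

Lemma op_le_unitary_diag (d : 'I_n -> C) c :
  0 <= c -> (forall i, `|d i| <= c) -> op_le (unitary_diag P d) c.
Proof. by move=> c0 dc; apply: op_le_conj_diag => // i; rewrite mxE. Qed.

(** Row i of [P] is an eigenvector. This carries hypotheses on eigenvalues over to the diagonal
    entries. *)
Lemma eigenvalue_unitary_diag (d : 'I_n -> C) i :
  eigenvalue (unitary_diag P d) (d i).
Proof.
apply/eigenvalueP; exists (row i P).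
  rewrite -row_mul /unitary_diag !mulmxA (unitarymxP P_unitary) mul1mx.
  by apply/rowP => j; rewrite mul_diag_mx !mxE.
apply/eqP => Pi0; have /row_unitarymxP/(_ i i) := P_unitary.
by rewrite Pi0 linear0l eqxx => /eqP; rewrite eq_sym oner_eq0.
Qed.

End UnitaryDiag.

Lemma normal_unitary_diag (C : numClosedFieldType) (n : nat) (A : 'M[C]_n) :
  A \is normalmx ->
  exists P : 'M[C]_n, exists2 d, P \is unitarymx & A = unitary_diag P d.
Proof.
move=> /orthomx_spectralP AE; exists (spectralmx A).
exists (fun i => spectral_diag A 0 i); first exact: spectral_unitarymx.
rewrite {1}AE invmx_unitary ?spectral_unitarymx // /unitary_diag.
by congr (_ *m diag_mx _ *m _); apply/rowP => i; rewrite mxE.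
Qed.

(** * Disk geometry and Cayley transforms *)

Lemma normc_le (R : rcfType) (a : R[i]) (c : R) : 0 <= c ->
  (`|a| <= c%:C) = (complex.Re a ^+ 2 + complex.Im a ^+ 2 <= c ^+ 2).
Proof.
move=> c0; rewrite -(@ler_pXn2r _ 2) ?nnegrE ?normr_ge0 ?ler0c //.
by rewrite -add_Re2_Im2 -rmorphXn lecR.
Qed.

Section Disk.
Variables (R : rcfType) (z0 eta phi : R).

Lemma disk_cayley (a : R[i]) : 0 < eta -> 0 < phi -> phi < z0 ->
  phi ^+ 2 = z0 ^+ 2 - eta ^+ 2 -> `|a - z0%:C| <= eta%:C ->
  `|a - phi%:C| <= (Num.sqrt ((z0 - phi) / (z0 + phi)))%:C * `|a + phi%:C|.
Proof.
move=> eta_gt0 phi_gt0 phi_lt sqr_phi ha.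
rewrite -(@ler_pXn2r _ 2) ?nnegrE ?mulr_ge0 ?normr_ge0 ?ler0c ?sqrtr_ge0 //.
rewrite exprMn -!add_Re2_Im2 -rmorphXn -rmorphM lecR /=.
rewrite sqr_sqrtr; last by apply: divr_ge0; lra.
move: ha; rewrite (normc_le _ (ltW eta_gt0)); case: a => x y /=.
rewrite !(addr0, subr0, oppr0) => h.
rewrite mulrAC ler_pdivlMr; last by lra.
(* With the denominator cleared and phi^2 = z0^2 - eta^2, right side minus left side is exactly
   twice this product. *)
have : 0 <= phi * (eta ^+ 2 - ((x - z0) ^+ 2 + y ^+ 2)) by apply: mulr_ge0; lra.
by nra.
Qed.

(** The point of the disk nearest to -phi is z0 - eta. *)
Lemma disk_resolvent (a : R[i]) : 0 < eta -> eta < z0 -> 0 < phi ->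
  `|a - z0%:C| <= eta%:C -> (z0 - eta + phi)%:C <= `|a + phi%:C|.
Proof.
move=> eta_gt0 eta_lt phi_gt0 ha.
rewrite -(@ler_pXn2r _ 2) ?nnegrE ?normr_ge0 ?ler0c //; last by lra.
rewrite -add_Re2_Im2 -rmorphXn lecR.
move: ha; rewrite (normc_le _ (ltW eta_gt0)); case: a => x y /=.
rewrite !(addr0, subr0, oppr0) => h.
have : z0 - eta <= x by nra.
by nra.
Qed.

Lemma disk_norm (a : R[i]) : 0 < eta -> eta < z0 ->
  `|a - z0%:C| <= eta%:C -> `|a| <= (z0 + eta)%:C.
Proof.
move=> eta_gt0 eta_lt ha; rewrite -[a](subrK z0%:C) rmorphD /= addrC.
rewrite (le_trans (ler_normD _ _)) // lerD //.
by rewrite ger0_norm // ler0c; lra.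
Qed.

(** In an eigenbasis of [A] all these matrices are diagonal, so each bound reduces to one at a point
    of the disk. Commutation is recorded because the ADI step has the resolvent on the left of one
    Cayley factor and on the right of the other. *)
Lemma normal_cayley (n : nat) (A : 'M[R[i]]_n) :
  0 < eta -> eta < z0 -> 0 < phi -> phi < z0 ->
  phi ^+ 2 = z0 ^+ 2 - eta ^+ 2 ->
  normal_mx A -> (forall a : R[i], eigenvalue A a -> `|a - z0%:C| <= eta%:C) ->
  exists2 S : 'M[R[i]]_n, S *m (conjT A + phi%:C%:M) = 1%:M &
   [/\ op_le (conjT A) (z0 + eta)%:C,
    op_le S ((z0 - eta + phi)^-1)%:C,
    (conjT A - phi%:C%:M) *m S = S *m (conjT A - phi%:C%:M) &
    op_le (S *m (conjT A - phi%:C%:M)) (Num.sqrt ((z0 - phi) / (z0 + phi)))%:C].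
Proof.
move=> eta_gt0 eta_lt phi_gt0 phi_lt sqr_phi.
rewrite /normal_mx conjTE => /normalmxP/normal_unitary_diag[P [s Pu AE]] eA.
pose t i := Num.conj (s i).
(* Conjugation preserves the disk, whose centre is real. *)
have tE i : `|t i - z0%:C| <= eta%:C.
  have /eA : eigenvalue A (s i) by rewrite AE; exact: eigenvalue_unitary_diag.
  have z0C : Num.conj z0%:C = z0%:C :> R[i].
    by apply/conj_Creal; rewrite complex_real.
  by rewrite /t -[in X in _ -> X]z0C -rmorphB norm_conjC.
have t_phi_gt0 i : 0 < `|t i + phi%:C|.
  apply: lt_le_trans (disk_resolvent eta_gt0 eta_lt phi_gt0 (tE i)).
  by rewrite ltcR; lra.
have AtE : A^t* = unitary_diag P t.
  by rewrite AE; exact: unitary_diag_adjoint.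
rewrite AtE.
pose S := unitary_diag P (fun i => (t i + phi%:C)^-1).
have -> : unitary_diag P t + phi%:C%:M = unitary_diag P (fun i => t i + phi%:C).
  rewrite -(unitary_diag_const Pu).
  exact: unitary_diagD.
have -> : unitary_diag P t - phi%:C%:M = unitary_diag P (fun i => t i - phi%:C).
  rewrite -(unitary_diag_const Pu).
  rewrite unitary_diagN.
  exact: unitary_diagD.
exists S.
  rewrite (unitary_diagM Pu) -(unitary_diag_const Pu).
  by apply: eq_unitary_diag => i; rewrite mulVf // -normr_gt0.
split.
- apply: (op_le_unitary_diag Pu) => [|i]; first by rewrite ler0c; lra.
  exact: disk_norm (tE i).
- apply: (op_le_unitary_diag Pu) => [|i]; first by rewrite ler0c invr_ge0; lra.
  rewrite normfV fmorphV lef_pV2 ?posrE // ?ltcR; last by lra.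
  exact: disk_resolvent (tE i).
- rewrite [LHS](unitary_diagM Pu) [RHS](unitary_diagM Pu).
  by apply: eq_unitary_diag => i; rewrite mulrC.
- rewrite (unitary_diagM Pu).
  apply: (op_le_unitary_diag Pu) => [|i]; first by rewrite ler0c sqrtr_ge0.
  rewrite normrM normfV mulrC ler_pdivrMr //.
  exact: disk_cayley (tE i).
Qed.

End Disk.

(** * The ADI step *)

Lemma adi_step (F : fieldType) (m n : nat) (N G : 'M[F]_(n, m))
    (B S : 'M[F]_n) (A T : 'M[F]_m) (p : F) :
  N *m A + B *m N = G -> S *m (B + p%:M) = 1%:M -> (A + p%:M) *m T = 1%:M ->
  N = (S *m (B - p%:M)) *m N *m ((A - p%:M) *m T) + (p *+ 2) *: (S *m G *m T).
Proof.
move=> NG SB AT.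
have {1}-> : N = S *m ((B + p%:M) *m N *m (A + p%:M)) *m T.
  by rewrite !mulmxA SB mul1mx -mulmxA AT mulmx1.
have -> : (B + p%:M) *m N *m (A + p%:M) =
    (B - p%:M) *m N *m (A - p%:M) + (p *+ 2) *: G.
  (* Replacing q by -q changes only the middle term of this expansion, so the two shifted products
     differ by 2pG. *)
  have expand q : (B + q%:M) *m N *m (A + q%:M) =
      B *m N *m A + q *: G + q ^+ 2 *: N.
    rewrite -NG mulmxDl !mulmxDr !mulmxDl !mul_scalar_mx !mul_mx_scalar.
    by rewrite -scalemxAl scalerA scalerDr !addrA.
  have -> : B - p%:M = B + (- p)%:M by rewrite raddfN.
  have -> : A - p%:M = A + (- p)%:M by rewrite raddfN.
  rewrite !expand sqrrN scaleNr mulr2n scalerDl [RHS]addrAC.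
  by rewrite -[_ - _ + _]addrA addKr.
by rewrite mulmxDr mulmxDl -scalemxAr -scalemxAl !mulmxA.
Qed.

(** * Triangular numbers and scalar estimates *)

(** For t = k(k+1)/2 the number 8t+1 is the square of 2k+1, so the exponent in the final bound is
    -k. *)
Lemma triangular_sqrt (R : rcfType) (k : nat) :
  Num.sqrt (8 * ('C(k.+1, 2))%:R + 1) = 2 * k%:R + 1 :> R.
Proof.
have e : 2 * ('C(k.+1, 2))%:R = k%:R * (k%:R + 1) :> R.
  by rewrite natr1 -!natrM -(mul_bin_diag k.+1 1) bin1 mulnC.
rewrite (_ : 8 * _ + 1 = (2 * k%:R + 1) ^+ 2); last by nra.
by rewrite sqrtr_sqr ger0_norm // addr_ge0 // mulr_ge0.
Qed.

(** From 2t = k(k+1) >= k^2 and 3/2 > sqrt 2. *)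
Lemma le_triangular_sqrt (R : rcfType) (k : nat) :
  k%:R <= 3 / 2 * Num.sqrt ('C(k.+1, 2))%:R :> R.
Proof.
have e : 2 * ('C(k.+1, 2))%:R = k%:R * (k%:R + 1) :> R.
  by rewrite natr1 -!natrM -(mul_bin_diag k.+1 1) bin1 mulnC.
have k0 : 0 <= k%:R :> R by [].
have s0 := sqrtr_ge0 ('C(k.+1, 2)%:R : R).
have := sqr_sqrtr (ler0n R 'C(k.+1, 2)).
set s := Num.sqrt _ in s0 * => s2.
by nra.
Qed.

Lemma mu1_kappa_bounds (R : rcfType) (z0 eta phi : R) :
  0 < eta -> eta < z0 -> 0 < phi -> phi < z0 ->
  0 <= (z0 + phi) / (z0 - phi) /\ 1 <= (z0 + eta) / (z0 - eta).
Proof.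
move=> eta_gt0 eta_lt phi_gt0 phi_lt; split; first by apply: divr_ge0; lra.
by rewrite ler_pdivlMr; lra.
Qed.

(** The factor 4 phi joins the 2 phi of the ADI step to the 2 in |F| <= 2 (z0 + eta) |X|, and the
    square comes from two resolvents. The bound is the arithmetic-geometric mean inequality for z0 -
    eta and phi. *)
Lemma adi_constant (R : rcfType) (z0 eta phi : R) :
  0 < eta -> eta < z0 -> 0 < phi ->
  4 * phi * ((z0 - eta + phi)^-1) ^+ 2 * (z0 + eta) <= (z0 + eta) / (z0 - eta).
Proof.
move=> eta_gt0 eta_lt phi_gt0; rewrite mulrC ler_wpM2l //; first by lra.
rewrite exprVn ler_pdivrMr; last by apply: exprn_gt0; lra.
rewrite [leRHS]mulrC ler_pdivlMr; last by lra.
by have := sqr_ge0 (z0 - eta - phi); nra.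
Qed.

Lemma sqrt_disk (R : rcfType) (z0 eta : R) (phi := Num.sqrt (z0 ^+ 2 - eta ^+ 2)) :
  0 < eta -> eta < z0 ->
  [/\ 0 < phi, phi < z0 & phi ^+ 2 = z0 ^+ 2 - eta ^+ 2].
Proof.
move=> eta_gt0 eta_lt.
have phi_gt0 : 0 < phi by rewrite sqrtr_gt0 subr_sqr; apply: mulr_gt0; lra.
have sqr_phi : phi ^+ 2 = z0 ^+ 2 - eta ^+ 2.
  by rewrite sqr_sqrtr // subr_sqr; apply: mulr_ge0; lra.
split => //; move: (phi) phi_gt0 sqr_phi => p p_gt0 sqr_p.
have z0_gt0 : 0 < z0 by lra.
by nra.
Qed.

(** Here [d] bounds the resolvents, [c] the coefficient matrices, and [g] and [x] are the norms of
    [F] and [X]. *)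
Lemma adi_error_le (R : rcfType) (phi d c kappa K x g : R) :
  0 <= phi -> 0 <= d -> 0 <= K -> 0 <= x -> 4 * phi * d ^+ 2 * c <= kappa ->
  g <= 2 * c * x -> phi *+ 2 * (d * (K * g) * d) <= K * kappa * x.
Proof.
move=> phi0 d0 K0 x0 ckappa gx.
have -> : phi *+ 2 * (d * (K * g) * d) = 2 * phi * d ^+ 2 * K * g by ring.
apply: (@le_trans _ _ (2 * phi * d ^+ 2 * K * (2 * c * x))).
  by apply: ler_wpM2l => //; rewrite !mulr_ge0.
have -> : 2 * phi * d ^+ 2 * K * (2 * c * x) =
    4 * phi * d ^+ 2 * c * (K * x) by ring.
have -> : K * kappa * x = kappa * (K * x) by ring.
by apply: ler_wpM2r => //; apply: mulr_ge0.
Qed.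

(** Since c >= 1, the summand 1 is absorbed into c. *)
Lemma affine_le_mul (R : numDomainType) (c s k e x : R) :
  1 <= c -> 0 <= e -> 0 <= x -> k <= s ->
  e * (1 + k * c) * x <= c * (s + 1) * e * x.
Proof.
move=> c1 e0 x0 ks; apply: ler_wpM2r => //; rewrite mulrC; apply: ler_wpM2r => //.
rewrite mulrDr mulr1 addrC lerD // mulrC ler_wpM2l //.
exact: le_trans c1.
Qed.

(** * From the Sylvester equation to the singular values of [X] *)

Lemma norm2_sylvester_le (R : rcfType) (m n : nat) (X F : 'M[R[i]]_(m, n))
    (A : 'M[R[i]]_m) (B : 'M[R[i]]_n) (c : R) :
  (0 < n)%N -> 0 <= c -> X^t* *m A + B *m X^t* = F^t* ->
  op_le A c%:C -> op_le B c%:C -> norm2 F <= 2 * c * norm2 X.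
Proof.
move=> n0 c0 NG A_le B_le; have x0 := norm2_ge0 X.
have c0' : 0 <= c%:C by rewrite ler0c.
have x0' : 0 <= (norm2 X)%:C by rewrite ler0c.
have -> : 2 * c * norm2 X = norm2 X * c + c * norm2 X by ring.
apply: norm2_le; first exact: addr_ge0 (mulr_ge0 x0 c0) (mulr_ge0 c0 x0).
rewrite -NG rmorphD !rmorphM; have X_le := op_le_norm2 X n0.
exact: op_leD (op_leM c0' X_le A_le) (op_leM x0' B_le X_le).
Qed.

Lemma sing_val_triangular (R : rcfType) (m n k : nat)
    (A : 'M[R[i]]_m) (B : 'M[R[i]]_n) (X F : 'M[R[i]]_(m, n))
    (z0 eta phi K : R) :
  0 < eta -> eta < z0 -> 0 < phi -> phi < z0 ->
  phi ^+ 2 = z0 ^+ 2 - eta ^+ 2 ->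
  normal_mx A -> normal_mx B -> A *m X - X *m B = F ->
  (forall a : R[i], eigenvalue A a -> `|a - z0%:C| <= eta%:C) ->
  (forall b : R[i], eigenvalue B b -> `|(- b) - z0%:C| <= eta%:C) ->
  0 <= K ->
  (forall j : nat, (j < n)%N ->
     sing_val F j.+1 <= K * ((z0 + phi) / (z0 - phi)) ^- j * norm2 F) ->
  (0 < n)%N -> (k < n)%N ->
  sing_val X ('C(k.+1, 2)).+1 <=
    ((z0 + phi) / (z0 - phi)) ^- k *
    (1 + k%:R * (K * ((z0 + eta) / (z0 - eta)))) * norm2 X.
Proof.
move=> eta_gt0 eta_lt phi_gt0 phi_lt sqr_phi.
have c0 : 0 <= z0 + eta by lra.
have d0 : 0 < (z0 - eta + phi)^-1 by rewrite invr_gt0; lra.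
have mu0 : 0 < (z0 + phi) / (z0 - phi) by apply: divr_gt0; lra.
have mu0V : 0 <= (z0 - phi) / (z0 + phi) by apply: divr_ge0; lra.
have hE := adi_constant eta_gt0 eta_lt phi_gt0.
move=> nA nB AXB eA eB K0 Fdecay n0 kn.
have nB' : normal_mx (- B).
  by rewrite /normal_mx !conjTN !mulNmx !mulmxN nB.
have eB' b : eigenvalue (- B) b -> `|b - z0%:C| <= eta%:C.
  move=> /eigenvalueP[v vB v0]; rewrite -[b]opprK; apply: eB.
  apply/eigenvalueP; exists v => //.
  by rewrite scaleNr -vB mulmxN opprK.
have [S SB [B_le S_le _ CB_le]] :=
  normal_cayley eta_gt0 eta_lt phi_gt0 phi_lt sqr_phi nB' eB'.
have [T TA [A_le T_le TC CA_le]] :=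
  normal_cayley eta_gt0 eta_lt phi_gt0 phi_lt sqr_phi nA eA.
(* Passing to -B turns the difference into a sum whose two coefficients both have spectrum in the
   disk. *)
have NG : X^t* *m conjT A + conjT (- B) *m X^t* = F^t*.
  by rewrite -AXB conjTN !conjTE [(_ - _)^T]raddfB map_mxB /=
             !trmx_mul !map_mxM mulNmx.
have X_le := op_le_norm2 X n0.
have x0 := norm2_ge0 X.
have g0 := norm2_ge0 F.
have FX := norm2_sylvester_le n0 c0 NG A_le B_le.
have NE := adi_step NG SB (mulmx1C TA).
set rho := Num.sqrt _ in CB_le CA_le.
set d := (z0 - eta + phi)^-1 in d0 hE S_le T_le.
set mu := (z0 + phi) / (z0 - phi) in mu0 Fdecay *.
(* The two Cayley factors together contract by 1/mu. *)
have rho2 : rho ^+ 2 = mu^-1 by rewrite sqr_sqrtr // invf_div.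
pose h := phi *+ 2 * (d * (K * norm2 F) * d).
have h0 : 0 <= h by rewrite !mulr_ge0 ?mulrn_wge0 // ltW.
rewrite TC in NE.
have H_approx i : (0 < i <= k)%N -> exists2 Z : 'M[R[i]]_(n, m),
    (\rank Z <= i)%N &
    op_le (phi%:C *+ 2 *: (S *m F^t* *m T) - Z) (h%:C * (rho%:C ^+ 2) ^+ i).
  move=> /andP[i0 ik]; have i_lt : (i < n)%N := leq_ltn_trans ik kn.
  have [Z rZ FZ] := low_rank_approx F i_lt.
  (* A truncation of [F^t*] between the two resolvents keeps its rank and inherits the decay of the
     singular values of [F]. *)
  exists (phi%:C *+ 2 *: (S *m Z *m T)).
    rewrite (leq_trans (mxrank_scale _ _)) // (leq_trans (mxrankM_maxl _ _)) //.
    by rewrite (leq_trans (mxrankM_maxr _ _)).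
  rewrite -scalerBr -mulmxBl -mulmxBr.
  have -> : h%:C * (rho%:C ^+ 2) ^+ i =
      `|phi%:C *+ 2| * (d%:C * (K * mu ^- i * norm2 F)%:C * d%:C).
    rewrite ger0_norm ?mulrn_wge0 ?ler0c ?ltW // -!rmorphXn rho2 -rmorphMn -!rmorphM.
    by congr _%:C; rewrite /h exprVn; ring.
  apply/op_leZ/op_leM => //; first by rewrite ler0c ltW.
  apply: op_leM => //; last by apply: op_le_trans FZ; rewrite lecR Fdecay.
  by rewrite ler0c !mulr_ge0 // invr_ge0 exprn_ge0 // ltW.
have [|||Y rY NY] := stein_low_rank _ _ _ NE CB_le CA_le X_le H_approx.
- by rewrite ler0c sqrtr_ge0.
- by rewrite ler0c.
- by rewrite ler0c.
have errE : (rho%:C ^+ 2) ^+ k * ((norm2 X)%:C + k%:R * h%:C) =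
    (mu ^- k * (norm2 X + k%:R * h))%:C.
  by rewrite -!rmorphXn rho2 -(rmorph_nat (real_complex R)) -rmorphM -rmorphD
             -rmorphM exprVn.
rewrite errE in NY.
have muk0 : 0 <= mu ^- k by rewrite invr_ge0 exprn_ge0 // ltW.
apply: le_trans (sing_val_le_rank _ rY NY) _.
  exact: mulr_ge0 muk0 (addr_ge0 x0 (mulr_ge0 (ler0n _ k) h0)).
rewrite -mulrA; apply: (ler_wpM2l muk0).
rewrite mulrDl mul1r lerD2l -mulrA; apply: (ler_wpM2l (ler0n _ k)).
exact: adi_error_le (ltW phi_gt0) (ltW d0) K0 x0 hE FX.
Qed.

Unset Implicit Arguments.
Local Close Scope sesquilinear_scope.

Theorem theorem4 (R : realType) (m n : nat)
  (A : 'M[R[i]]_m) (B : 'M[R[i]]_n) (X F : 'M[R[i]]_(m, n))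
  (z0 eta K : R) :
  (n <= m)%N ->
  normal_mx A -> normal_mx B ->
  A *m X - X *m B = F ->
  0 < eta -> eta < z0 ->
  (forall a : R[i], eigenvalue A a -> `|a - z0%:C| <= eta%:C) ->
  (forall b : R[i], eigenvalue B b -> `|(- b) - z0%:C| <= eta%:C) ->
  let phi := Num.sqrt (z0 ^+ 2 - eta ^+ 2) in
  let mu1 := (z0 + phi) / (z0 - phi) in
  1 <= K ->
  (forall j : nat, (j < n)%N -> sing_val F j.+1 <= K * mu1 ^- j * norm2 F) ->
  forall k t : nat, (0 < k)%N -> t = (k * k.+1 %/ 2)%N -> (1 <= t < n)%N ->
    sing_val X t.+1 <=
      K * ((z0 + eta) / (z0 - eta))
        * (3 / 2 * Num.sqrt (t%:R) + 1)
        * powR mu1 (- ((Num.sqrt (8 * t%:R + 1) - 1) / 2))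
        * norm2 X.
Proof.
move=> _ nA nB AXB eta_gt0 eta_lt eA eB phi mu1 K1 Fdecay k t k0 tE /andP[t1 tn].
have [phi_gt0 phi_lt sqr_phi] := sqrt_disk eta_gt0 eta_lt.
have {}tE : t = 'C(k.+1, 2) by rewrite tE bin2 divn2 mulnC.
(* Hence k < n, and the decay hypothesis covers every rank up to k. *)
have kt : (k <= t)%N by rewrite tE binS bin1 leq_addl.
have := sing_val_triangular eta_gt0 eta_lt phi_gt0 phi_lt sqr_phi nA nB AXB eA eB
  (le_trans ler01 K1) Fdecay (leq_trans t1 (ltnW tn)) (leq_ltn_trans kt tn).
rewrite -tE => /le_trans; apply.
have [mu1_ge0 kappa1] := mu1_kappa_bounds eta_gt0 eta_lt phi_gt0 phi_lt.
rewrite -/mu1 in mu1_ge0 *.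
have -> : powR mu1 (- ((Num.sqrt (8 * t%:R + 1) - 1) / 2)) = mu1 ^- k.
  rewrite tE triangular_sqrt addrK [2 * _]mulrC mulfK ?pnatr_eq0 //.
  by rewrite powRN powR_mulrn.
have := le_triangular_sqrt R k; rewrite -tE => ks.
(* Here c is K (z0 + eta) / (z0 - eta), at least 1 as a product of two such factors. *)
apply: affine_le_mul ks; last exact: norm2_ge0.
  by rewrite -[1]mulr1 ler_pM.
by rewrite invr_ge0 exprn_ge0.
Qed.
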